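(* Let $n\ge2$ and let $\mathcal L$ be an $n$-Lie algebra over a field $\mathbb F$, with associated Lie algebra $\widetilde{\mathcal L}$. Then any module $\mathcal M$ over the $n$-Lie algebra $\mathcal L$ is a module over the Lie algebra $\widetilde{\mathcal L}$ with the action $x*m=[x_1,\dots,x_{n-1},m]$ for $x=x_1\wedge\dots\wedge x_{n-1}$, and this action satisfies, for all $x_i,y_j\in\mathcal L$ and $m\in\mathcal M$, the Balanced Equality $$ad_{x_1\wedge\dots\wedge x_{n-2}\wedge[y_1,\dots,y_n]}*m=\sum_{i=1}^n(-1)^{n+i}\,ad_{y_1\wedge\dots\wedge y_{i-1}\wedge y_{i+1}\wedge\dots\wedge y_n}*\big(ad_{x_1\wedge\dots\wedge x_{n-2}\wedge y_i}*m\big).$$ Conversely, any module over the Lie algebra $\widetilde{\mathcal L}$ which satisfies the Balanced Equality is a module over the $n$-Lie algebra $\mathcal L$, with $[x_1,\dots,x_{n-1},m]:=ad_{x_1\wedge\dots\wedge x_{n-1}}*m$.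
   Context: An $n$-Lie algebra is a vector space with a skew-symmetric $n$-ary bracket satisfying $[x_1,\dots,x_{n-1},[y_1,\dots,y_n]]=\sum_{i=1}^n[y_1,\dots,[x_1,\dots,x_{n-1},y_i],\dots,y_n]$. A module over an $n$-Lie algebra $\mathcal L$ is a vector space $\mathcal M$ together with an $n$-Lie algebra structure on $\mathcal L\oplus\mathcal M$ having $\mathcal L$ as a subalgebra and $\mathcal M$ as an abelian ideal (brackets with at least two arguments in $\mathcal M$ vanish); the bracket with $m\in\mathcal M$ in another position is obtained from $[x_1,\dots,x_{n-1},m]$ by skew-symmetry. On $\wedge^{n-1}\mathcal L$ define $[x,y]_\wedge=\sum_{i=1}^{n-1}y_1\wedge\dots\wedge[x_1,\dots,x_{n-1},y_i]\wedge\dots\wedge y_{n-1}$ for $x=x_1\wedge\dots\wedge x_{n-1}$, $y=y_1\wedge\dots\wedge y_{n-1}$, and let $ad_x(z)=[x_1,\dots,x_{n-1},z]$ for $z\in\mathcal L$ (extended linearly in $x$). $\mathrm{Ker}(ad_\wedge)=\{x\in\wedge^{n-1}\mathcal L: ad_x=0\}$ is an ideal, and $\widetilde{\mathcal L}:=\wedge^{n-1}\mathcal L/\mathrm{Ker}(ad_\wedge)$ with the induced bracket is a Lie algebra, isomorphic via $x\mapsto ad_x$ to the Lie algebra of inner derivations $\mathrm{InDer}(\mathcal L)$. In the Balanced Equality, $ad_x*m$ denotes the action on $m$ of the class of $x$ in $\widetilde{\mathcal L}\cong\mathrm{InDer}(\mathcal L)$.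
   Formalization: The action of ∧^{n-1}L on M need not vanish on Ker(ad) (e.g. abelian L of dimension n-1 acting on a line by the determinant), so M is shown to be a module over L~ with the stated action exactly when Ker(ad) acts by zero on M. *)

(* Defs.v *)
From HB Require Import structures.
(* freeg first: it exports a [lift] that would otherwise hide fintype.lift *)
From mathcomp Require Import freeg.
From mathcomp Require Import all_boot all_order all_algebra.
From mathcomp Require Import generic_quotient ring_quotient.
From mathcomp Require Import boolp.

Set Implicit Arguments.
Unset Strict Implicit.
Unset Printing Implicit Defensive.

Import GRing.Theory.
Local Open Scope ring_scope.
Local Open Scope quotient_scope.

Section Submodule.
Variables (F : fieldType) (V : lmodType F).

Definition submodule (U : V -> Prop) : Prop :=
  U 0 /\ forall (c : F) (u v : V), U u -> U v -> U (c *: u + v).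

Definition spanned (S : V -> Prop) : V -> bool :=
  fun v => `[< forall U, submodule U -> (forall s, S s -> U s) -> U v >].

Lemma spanned_submod S : submod_closed (spanned S).
Proof.
split; first by apply/asboolP => U [].
move=> c u v /asboolP Hu /asboolP Hv; apply/asboolP => U HU HS.
by case: (HU) => _; apply; [exact: Hu | exact: Hv].
Qed.

End Submodule.

Section QuotientModule.
Variables (F : fieldType) (V : lmodType F) (I : V -> bool).

Definition lmem (HI : submod_closed I) : V -> bool := I.
HB.instance Definition _ HI :=
  GRing.isSubmodClosed.Build F V (lmem HI) HI.

Variable HI : submod_closed I.

Definition lzmod := GRing.ZmodClosed.clone V (lmem HI) _.

Definition lquot : Type := @Quotient.quot V lzmod.
HB.instance Definition _ := GRing.Zmodule.on lquot.

Definition lpi (v : V) : lquot := \pi_(@Quotient.quot V lzmod) v.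
Definition lrepr (q : lquot) : V := repr (q : @Quotient.quot V lzmod).

Lemma lreprK q : lpi (lrepr q) = q.
Proof. exact: reprK. Qed.

Lemma lpi_eq u v : lpi u = lpi v <-> I (u - v).
Proof.
by have := Quotient.idealrBE lzmod u v; rewrite unfold_in => ->; split=> /eqP.
Qed.

Lemma lrepr_lpi v : I (lrepr (lpi v) - v).
Proof. by apply/lpi_eq; rewrite lreprK. Qed.

Lemma lpiD u v : lpi (u + v) = lpi u + lpi v.
Proof. exact: (raddfD (\pi_(@Quotient.quot V lzmod))). Qed.

Definition lscale (c : F) (q : lquot) : lquot := lpi (c *: lrepr q).

Lemma lpiZ c v : lpi (c *: v) = lscale c (lpi v).
Proof.
apply/lpi_eq; rewrite -scalerBr -opprB scalerN.
have /(rpredZ c) : lrepr (lpi v) - v \in lmem HI by exact: lrepr_lpi.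
by move=> H; rewrite -[I _]/(- _ \in lmem HI) rpredN.
Qed.

Lemma lscaleA a b q : lscale a (lscale b q) = lscale (a * b) q.
Proof. by rewrite -(lreprK q) -!lpiZ scalerA. Qed.
Lemma lscale1 : left_id 1 lscale.
Proof. by move=> q; rewrite -(lreprK q) -!lpiZ scale1r. Qed.
Lemma lscaleDr : right_distributive lscale +%R.
Proof.
move=> a p q.
by rewrite -(lreprK p) -(lreprK q) -!lpiZ -!lpiD -lpiZ scalerDr.
Qed.
Lemma lscaleDl q : {morph lscale^~ q : a b / a + b}.
Proof. by move=> a b; rewrite -(lreprK q) -!lpiZ -!lpiD scalerDl. Qed.

HB.instance Definition _ := GRing.Zmodule_isLmodule.Build F lquot
  lscaleA lscale1 lscaleDr lscaleDl.

Lemma lpi_linear c u v : lpi (c *: u + v) = c *: lpi u + lpi v.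
Proof. by rewrite lpiD lpiZ. Qed.

HB.instance Definition _ := GRing.isLinear.Build F V lquot _ lpi lpi_linear.

End QuotientModule.

Section Families.
Variable V : Type.

(* (x_1, ..., x_k, z) *)
Definition snoc k (x : {ffun 'I_k -> V}) (z : V) : {ffun 'I_k.+1 -> V} :=
  [ffun i => oapp x z (unlift ord_max i)].

Definition upd k (x : {ffun 'I_k -> V}) (i : 'I_k) (z : V) :
    {ffun 'I_k -> V} :=
  [ffun j => if j == i then z else x j].

Definition del k (y : {ffun 'I_k.+1 -> V}) (i : 'I_k.+1) :
    {ffun 'I_k -> V} :=
  [ffun j => y (lift i j)].

Lemma snoc_max k (x : {ffun 'I_k -> V}) z : snoc x z ord_max = z.
Proof. by rewrite ffunE unlift_none. Qed.

Lemma snoc_lift k (x : {ffun 'I_k -> V}) z i : snoc x z (lift ord_max i) = x i.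
Proof. by rewrite ffunE liftK. Qed.

Lemma upd_snoc_lift k (x : {ffun 'I_k -> V}) z i u :
  upd (snoc x z) (lift ord_max i) u = snoc (upd x i u) z.
Proof.
apply/ffunP => j; rewrite !ffunE; case: unliftP => [j'|] -> /=.
  by rewrite (inj_eq (@lift_inj _ _)) ffunE.
by rewrite (negPf (neq_lift _ _)).
Qed.

Lemma upd_snoc_max k (x : {ffun 'I_k -> V}) z u :
  upd (snoc x z) ord_max u = snoc x u.
Proof.
apply/ffunP => j; rewrite !ffunE; case: unliftP => [j'|] -> /=.
  by rewrite eq_sym (negPf (neq_lift _ _)).
by rewrite eqxx.
Qed.

Lemma upd_upd k (x : {ffun 'I_k -> V}) i u v : upd (upd x i u) i v = upd x i v.
Proof. by apply/ffunP => j; rewrite !ffunE; case: eqP. Qed.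

Lemma upd_id k (x : {ffun 'I_k -> V}) i : upd x i (x i) = x.
Proof. by apply/ffunP => j; rewrite !ffunE; case: eqP => [->|]. Qed.

Lemma updC k (x : {ffun 'I_k -> V}) i j u v :
  i != j -> upd (upd x i u) j v = upd (upd x j v) i u.
Proof.
move=> ij; apply/ffunP => l; rewrite !ffunE.
by case: (eqVneq l j) => // ->; rewrite eq_sym (negPf ij).
Qed.

End Families.

Section LinearMap.
Variables (F : fieldType) (V W : lmodType F) (g : V -> W).
Hypothesis gL : forall (c : F) u v, g (c *: u + v) = c *: g u + g v.

Lemma lin0 : g 0 = 0.
Proof.
have := gL 1 0 0; rewrite !scale1r addr0.
by move/(congr1 (fun w => w - g 0)); rewrite subrr addrK.
Qed.

Lemma linD u v : g (u + v) = g u + g v.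
Proof. by rewrite -[u]scale1r gL !scale1r. Qed.

Lemma linB u v : g (u - v) = g u - g v.
Proof. by rewrite addrC -scaleN1r gL scaleN1r addrC. Qed.

Lemma lin_sum I (r : seq I) (P : pred I) (G : I -> V) :
  g (\sum_(i <- r | P i) G i) = \sum_(i <- r | P i) g (G i).
Proof. exact: (big_morph g linD lin0). Qed.

End LinearMap.

Section Multilinear.
Variables (F : fieldType) (V W : lmodType F) (k : nat).
Implicit Type f : {ffun 'I_k -> V} -> W.

Definition multilinear f : Prop :=
  forall i (x : {ffun 'I_k -> V}) (c : F) u v,
  f (upd x i (c *: u + v)) = c *: f (upd x i u) + f (upd x i v).

(* Equivalent to sign change under transpositions when 2 is invertible; in  *)
(* characteristic 2 this is what makes f factor through the exterior power. *)
Definition alternating f : Prop := forall (x : {ffun 'I_k -> V}) i j,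
  i != j -> x i = x j -> f x = 0.

Lemma multilinear0 f i x : multilinear f -> f (upd x i 0) = 0.
Proof. by move=> fM; apply: (lin0 (g := fun z => f (upd x i z))). Qed.

Lemma alternating_swap f i j x u v : multilinear f -> alternating f ->
  i != j -> f (upd (upd x i u) j v) + f (upd (upd x i v) j u) = 0.
Proof.
move=> fM fA ij; have ji : j != i by rewrite eq_sym.
have fD l t a b : f (upd t l (a + b)) = f (upd t l a) + f (upd t l b).
  exact: (linD (g := fun z => f (upd t l z)) (fM l t)).
have f0 a : f (upd (upd x i a) j a) = 0.
  by apply: (fA _ i j ij); rewrite !ffunE (negPf ij) !eqxx.
have := f0 (u + v); rewrite fD !(updC _ _ _ ij) !fD -!(updC _ _ _ ij) !f0.
by rewrite add0r addr0 addrC.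
Qed.

End Multilinear.

(* The k-th exterior power: the free space on k-tuples modulo the usual      *)
(* relations.                                                                *)
Section Wedge.
Variables (F : fieldType) (k : nat) (V : lmodType F).
Local Notation X := {ffun 'I_k -> V}.

Definition gen (x : X) : {freeg X / F} := [freeg [:: (1, x)]].

Inductive wedge_rel : {freeg X / F} -> Prop :=
| WedgeLin i x c u v :
    wedge_rel (gen (upd x i (c *: u + v))
               - (c *: gen (upd x i u) + gen (upd x i v)))
| WedgeAlt (x : X) i j : i != j -> x i = x j -> wedge_rel (gen x).

Definition wedge : lmodType F := lquot (spanned_submod wedge_rel).

(* x_1 /\ ... /\ x_k *)
Definition wedgev (x : X) : wedge := lpi (spanned_submod wedge_rel) (gen x).

Lemma wedgev_multilinear : multilinear wedgev.
Proof.
move=> i x c u v; rewrite /wedgev -lpi_linear; apply/lpi_eq.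
by apply/asboolP => U _; apply; constructor.
Qed.

Lemma wedgev_alternating : alternating wedgev.
Proof.
move=> x i j ij xij; rewrite /wedgev -(raddf0 (lpi (spanned_submod wedge_rel))).
apply/lpi_eq; rewrite subr0; apply/asboolP => U _; apply.
exact: (WedgeAlt ij xij).
Qed.

Lemma wedge_ind (P : wedge -> Prop) :
  P 0 -> (forall c x z, P z -> P (c *: wedgev x + z)) -> forall z, P z.
Proof.
move=> P0 PD z; rewrite -(lreprK z) -[lrepr z]freeg_sumE.
elim: (dom _) => [|x s IH]; first by rewrite big_nil raddf0.
rewrite big_cons.
have -> : << coeff x (lrepr z) *g x >> = coeff x (lrepr z) *: gen x.
  by apply/eqP/freeg_eqP => y; rewrite coeffZ !coeffU mul1r.
by rewrite lpi_linear; apply: PD.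
Qed.

Section Lift.
Variables (W : lmodType F) (f : X -> W).

(* The linear map on the exterior power with x_1 /\ ... /\ x_k |-> f x, for  *)
(* f multilinear and alternating; see wedge_liftE.                           *)
Definition wedge_lift (z : wedge) : W := fglift f (lrepr z).

Lemma fglift_linear c u v :
  fglift f (c *: u + v) = c *: fglift f u + fglift f v.
Proof.
have fB := @lift_is_additive F X W f.
have f0 : fglift f 0 = 0 by rewrite -(subrr 0) fB subrr.
have fN y : fglift f (- y) = - fglift f y by rewrite -sub0r fB f0 sub0r.
have fD : {morph fglift f : a b / a + b}.
  by move=> a b; rewrite -{1}[b]opprK fB fN opprK.
have fsum := big_morph _ fD f0.
rewrite fD; congr (_ + _).
rewrite -{2}[u]freeg_sumE {1}/GRing.scale /= /fgscale !fsum scaler_sumr.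
by apply: eq_bigr => x _; rewrite !liftU scalerA.
Qed.

Hypotheses (fM : multilinear f) (fA : alternating f).

Lemma wedge_lift_lpi d : wedge_lift (lpi _ d) = fglift f d.
Proof.
have f0 := lin0 fglift_linear.
have /asboolP H := lrepr_lpi (spanned_submod wedge_rel) d.
have: fglift f (lrepr (lpi (spanned_submod wedge_rel) d) - d) = 0.
  apply: (H (fun e => fglift f e = 0)).
    split=> // c u v Hu Hv; by rewrite fglift_linear Hu Hv scaler0 addr0.
  move=> s [i x c u v|x i j ij xij]; last by rewrite liftU scale1r (fA ij).
  by rewrite (linB fglift_linear) fglift_linear !liftU !scale1r fM subrr.
by rewrite (linB fglift_linear) => /subr0_eq.
Qed.

Lemma wedge_liftE x : wedge_lift (wedgev x) = f x.
Proof. by rewrite wedge_lift_lpi liftU scale1r. Qed.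

Lemma wedge_lift_linear c u v :
  wedge_lift (c *: u + v) = c *: wedge_lift u + wedge_lift v.
Proof.
by rewrite -(lreprK u) -(lreprK v) -lpi_linear !wedge_lift_lpi fglift_linear.
Qed.

End Lift.
End Wedge.

Record lieAlgebra (F : fieldType) := LieAlgebra {
  lie_sort :> lmodType F;
  lbr : lie_sort -> lie_sort -> lie_sort;
  lbr_linearl : forall c x y z, lbr (c *: x + y) z = c *: lbr x z + lbr y z;
  lbr_linearr : forall c x y z, lbr z (c *: x + y) = c *: lbr z x + lbr z y;
  lbrxx : forall x, lbr x x = 0;
  lbr_jacobi : forall x y z,
    lbr x (lbr y z) + lbr y (lbr z x) + lbr z (lbr x y) = 0 }.

Record lieModule (F : fieldType) (g : lieAlgebra F) (M : lmodType F) :=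
  LieModule {
  lact :> g -> M -> M;
  lact_linearl : forall c x y m, lact (c *: x + y) m = c *: lact x m + lact y m;
  lact_linearr : forall c x m p, lact x (c *: m + p) = c *: lact x m + lact x p;
  lact_lbr : forall x y m,
    lact (lbr x y) m = lact x (lact y m) - lact y (lact x m) }.

(* The arity of the brackets below is n.+2 with n : nat, i.e. any integer    *)
(* at least 2.                                                               *)
Definition nLie_axioms (F : fieldType) (n : nat) (V : lmodType F)
    (br : {ffun 'I_n.+2 -> V} -> V) : Prop :=
  [/\ multilinear br, alternating br &
      forall (x : {ffun 'I_n.+1 -> V}) (y : {ffun 'I_n.+2 -> V}),
        br (snoc x (br y)) = \sum_i br (upd y i (br (snoc x (y i))))].

Record nLieAlgebra (F : fieldType) (n : nat) := NLieAlgebra {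
  nlie_sort :> lmodType F;
  nbr : {ffun 'I_n.+2 -> nlie_sort} -> nlie_sort;
  nbr_nLie : nLie_axioms nbr }.

Section AssociatedLie.
Variables (F : fieldType) (n : nat) (L : nLieAlgebra F n).
Local Notation W := (wedge n.+1 L).

Definition ad (x : W) (z : L) : L :=
  wedge_lift (fun t : {ffun 'I_n.+1 -> L} => nbr (snoc t z)) x.

(* On y_1 /\ ... /\ y_{n-1} this is \sum_i y_1 /\ ... [x, y_i] ... /\ y_{n-1} *)
Definition wbr (x y : W) : W :=
  wedge_lift (fun t : {ffun 'I_n.+1 -> L} =>
    \sum_i wedgev (upd t i (ad x (t i)))) y.

Lemma nbr_snoc_multilinear z :
  multilinear (fun t : {ffun 'I_n.+1 -> L} => nbr (snoc t z)).
Proof.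
by case: (nbr_nLie L) => brM _ _ i x c u v; rewrite -!upd_snoc_lift brM.
Qed.

Lemma nbr_snoc_alternating z :
  alternating (fun t : {ffun 'I_n.+1 -> L} => nbr (snoc t z)).
Proof.
case: (nbr_nLie L) => _ brA _ x i j ij xij.
apply: (brA _ (lift ord_max i) (lift ord_max j)).
  by rewrite (inj_eq (@lift_inj _ _)).
by rewrite !snoc_lift.
Qed.

Lemma ad_wedgev t z : ad (wedgev t) z = nbr (snoc t z).
Proof.
exact: (wedge_liftE (@nbr_snoc_multilinear z) (@nbr_snoc_alternating z)).
Qed.

Lemma ad_linearl c x y z : ad (c *: x + y) z = c *: ad x z + ad y z.
Proof.
exact: (wedge_lift_linear (@nbr_snoc_multilinear z) (@nbr_snoc_alternating z)).
Qed.

Lemma ad0l z : ad 0 z = 0.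
Proof. exact: (lin0 (fun c x y => ad_linearl c x y z)). Qed.

Lemma ad_linearr c x u v : ad x (c *: u + v) = c *: ad x u + ad x v.
Proof.
case: (nbr_nLie L) => brM _ _.
elim/wedge_ind: x => [|a t x IH]; first by rewrite !ad0l scaler0 addr0.
rewrite !ad_linearl !ad_wedgev IH.
rewrite -(upd_snoc_max t 0) brM !upd_snoc_max !scalerDr !scalerA.
by rewrite [c * a]mulrC addrACA.
Qed.

Lemma ad_derivation x (y : {ffun 'I_n.+2 -> L}) :
  ad x (nbr y) = \sum_i nbr (upd y i (ad x (y i))).
Proof.
case: (nbr_nLie L) => brM _ brF.
elim/wedge_ind: x => [|a t x IH].
  by rewrite ad0l big1 // => i _; rewrite ad0l multilinear0.
rewrite ad_linearl ad_wedgev IH brF scaler_sumr -big_split /=.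
by apply: eq_bigr => i _; rewrite ad_linearl ad_wedgev brM.
Qed.

Section Deriv.
Variable x : W.
Let f (t : {ffun 'I_n.+1 -> L}) := \sum_i wedgev (upd t i (ad x (t i))).

Lemma wbr_multilinear : multilinear f.
Proof.
move=> i t c u v; rewrite /f scaler_sumr -big_split /=.
apply: eq_bigr => j _; have [->|ji] := eqVneq j i.
  by rewrite !upd_upd !ffunE eqxx ad_linearr wedgev_multilinear.
by rewrite !ffunE (negPf ji) 3?(updC _ _ _ (_ : i != j)) 1?eq_sym //
           wedgev_multilinear.
Qed.

Lemma wbr_alternating : alternating f.
Proof.
move=> t i j ij tij; rewrite /f (bigD1 i) //= (bigD1 j) 1?eq_sym //=.
rewrite big1 ?addr0 => [|l /andP[li lj]]; last first.
  apply: (wedgev_alternating ij).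
  by rewrite !ffunE ![_ == l]eq_sym (negPf li) (negPf lj).
have := alternating_swap t (ad x (t i)) (t j) (@wedgev_multilinear _ _ _)
  (@wedgev_alternating _ _ _) ij.
by rewrite (updC _ _ _ ij) upd_id -tij upd_id.
Qed.

End Deriv.

Lemma wbr_wedgev x t :
  wbr x (wedgev t) = \sum_i wedgev (upd t i (ad x (t i))).
Proof. exact: (wedge_liftE (@wbr_multilinear x) (@wbr_alternating x)). Qed.

Lemma wbr_linearr c x y z : wbr z (c *: x + y) = c *: wbr z x + wbr z y.
Proof. exact: (wedge_lift_linear (@wbr_multilinear z) (@wbr_alternating z)). Qed.

Lemma wbr0r x : wbr x 0 = 0.
Proof. exact: (lin0 (fun c u v => wbr_linearr c u v x)). Qed.

Lemma ad_wbr x y z : ad (wbr x y) z = ad x (ad y z) - ad y (ad x z).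
Proof.
have ad0r u : ad u 0 = 0 by exact: (lin0 (fun c => ad_linearr c u)).
elim/wedge_ind: y => [|a t y IH].
  by rewrite wbr0r !ad0l ad0r subr0.
rewrite wbr_linearr !ad_linearl IH ad_linearr opprD addrACA; congr (_ + _).
rewrite -scalerBr; congr (_ *: _).
rewrite wbr_wedgev !ad_wedgev ad_derivation.
rewrite [X in _ = X - _](bigD1_ord ord_max) //= snoc_max upd_snoc_max addrAC subrr add0r.
rewrite (lin_sum (g := ad^~ z) (fun c u v => ad_linearl c u v z)) /=.
by apply: eq_bigr => i _; rewrite ad_wedgev snoc_lift upd_snoc_lift.
Qed.

Definition ker_ad : W -> bool := fun x => `[< forall z, ad x z = 0 >].

Lemma ker_ad_submod : submod_closed ker_ad.
Proof.
split; first by apply/asboolP => z; rewrite ad0l.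
move=> c x y /asboolP Hx /asboolP Hy; apply/asboolP => z.
by rewrite ad_linearl Hx Hy scaler0 addr0.
Qed.

Definition tsort : lmodType F := lquot ker_ad_submod.
Definition tbr (p q : tsort) : tsort := lpi ker_ad_submod (wbr (lrepr p) (lrepr q)).

Lemma tsort_inj (p q : tsort) :
  (forall z, ad (lrepr p) z = ad (lrepr q) z) -> p = q.
Proof.
move=> H; rewrite -(lreprK p) -(lreprK q); apply/lpi_eq/asboolP => z.
by rewrite (linB (g := ad^~ z) (fun c u v => ad_linearl c u v z)) H subrr.
Qed.

Lemma ad_lrepr_lpi x z : ad (lrepr (lpi ker_ad_submod x)) z = ad x z.
Proof.
have /asboolP/(_ z) := lrepr_lpi ker_ad_submod x.
by rewrite (linB (g := ad^~ z) (fun c u v => ad_linearl c u v z)) => /subr0_eq.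
Qed.

Lemma tad_linear c (p q : tsort) z :
  ad (lrepr (c *: p + q)) z = c *: ad (lrepr p) z + ad (lrepr q) z.
Proof.
rewrite -{1}(lreprK p) -{1}(lreprK q) -lpi_linear ad_lrepr_lpi.
exact: ad_linearl.
Qed.

Lemma tbr_wbr x y : tbr (lpi ker_ad_submod x) (lpi ker_ad_submod y) = lpi ker_ad_submod (wbr x y).
Proof.
by apply: tsort_inj => z; rewrite !ad_lrepr_lpi !ad_wbr !ad_lrepr_lpi.
Qed.

Lemma tad_tbr (p q : tsort) z : ad (lrepr (tbr p q)) z =
  ad (lrepr p) (ad (lrepr q) z) - ad (lrepr q) (ad (lrepr p) z).
Proof. by rewrite ad_lrepr_lpi ad_wbr. Qed.

Lemma tbr_linearl c x y z : tbr (c *: x + y) z = c *: tbr x z + tbr y z.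
Proof.
apply: tsort_inj => w; rewrite tad_linear !tad_tbr !tad_linear ad_linearr.
by rewrite scalerBr opprD addrACA.
Qed.

Lemma tbr_linearr c x y z : tbr z (c *: x + y) = c *: tbr z x + tbr z y.
Proof.
apply: tsort_inj => w; rewrite tad_linear !tad_tbr !tad_linear ad_linearr.
by rewrite scalerBr opprD addrACA.
Qed.

Lemma tbrxx x : tbr x x = 0.
Proof.
apply: tsort_inj => w; rewrite tad_tbr subrr.
by rewrite -(raddf0 (lpi ker_ad_submod)) ad_lrepr_lpi ad0l.
Qed.

Lemma tbr_jacobi x y z : tbr x (tbr y z) + tbr y (tbr z x) + tbr z (tbr x y) = 0.
Proof.
have adB (p : tsort) u v : ad (lrepr p) (u - v) = ad (lrepr p) u - ad (lrepr p) v.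
  exact: (linB (fun c => ad_linearr c (lrepr p))).
have adD (p q : tsort) w : ad (lrepr (p + q)) w = ad (lrepr p) w + ad (lrepr q) w.
  have H := fun c u v => tad_linear c u v w.
  exact: (linD (g := fun r : tsort => ad (lrepr r) w) H).
apply: tsort_inj => w; rewrite -(raddf0 (lpi ker_ad_submod)).
rewrite ad_lrepr_lpi ad0l !adD !tad_tbr !adB.
have E (p q r s : L) : p - q - (r - s) = (p + s) - (q + r).
  by rewrite opprB addrACA opprD.
have J (a b c d e f : L) :
    a + d - (b + c) + (c + b - (f + e)) + (e + f - (d + a)) = 0.
  by rewrite [c + b]addrC [e + f]addrC [d + a]addrC !subrKA subrr.
by rewrite !E J.
Qed.

(* The quotient of the (n-1)-st exterior power by the kernel of ad, with the *)
(* bracket induced by wbr; see tbr_wbr.                                      *)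
Definition tildeL : lieAlgebra F :=
  LieAlgebra tbr_linearl tbr_linearr tbrxx tbr_jacobi.

Definition tclass (x : W) : tildeL := lpi ker_ad_submod x.

End AssociatedLie.

(* The n-Lie structure mbr on the direct sum of L and M extends that of L    *)
(* and makes M = {v | v.1 = 0} an abelian ideal.                             *)
Record nLieModule (F : fieldType) (n : nat) (L : nLieAlgebra F n)
    (M : lmodType F) := NLieModule {
  mbr : {ffun 'I_n.+2 -> L * M} -> L * M;
  mbr_nLie : nLie_axioms mbr;
  mbr_subalgebra : forall x : {ffun 'I_n.+2 -> L},
    mbr [ffun i => (x i, 0)] = (nbr x, 0);
  mbr_ideal : forall (v : {ffun 'I_n.+2 -> L * M}) i,
    (v i).1 = 0 -> (mbr v).1 = 0;
  mbr_abelian : forall (v : {ffun 'I_n.+2 -> L * M}) i j,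
    i != j -> (v i).1 = 0 -> (v j).1 = 0 -> mbr v = 0 }.

Section ModuleAction.
Variables (F : fieldType) (n : nat) (L : nLieAlgebra F n) (M : lmodType F).

(* [x_1, ..., x_{n-1}, m] *)
Definition nact (B : nLieModule L M) (x : {ffun 'I_n.+1 -> L}) (m : M) : M :=
  (mbr B (snoc [ffun i => (x i, 0)] (0, m))).2.

(* The same action extended linearly to the exterior power. It need not      *)
(* vanish on the kernel of ad, hence need not factor through tildeL: take L  *)
(* with zero bracket, of dimension n-1, acting on a line by the determinant. *)
Definition wact (B : nLieModule L M) (x : wedge n.+1 L) (m : M) : M :=
  wedge_lift (fun t => nact B t m) x.

Let emb (x : {ffun 'I_n.+1 -> L}) : {ffun 'I_n.+1 -> L * M} :=
  [ffun i => (x i, 0)].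

Lemma emb_upd x i c (u v : L) m :
  snoc (emb (upd x i (c *: u + v))) (0, m) =
  upd (snoc (emb x) (0, m)) (lift ord_max i) (c *: (u, 0) + (v, 0)) /\
  snoc (emb (upd x i u)) (0, m) =
  upd (snoc (emb x) (0, m)) (lift ord_max i) (u, 0).
Proof.
rewrite !upd_snoc_lift; split; congr snoc; apply/ffunP => j; rewrite !ffunE.
  by case: eqP => // _; congr pair; rewrite /= scaler0 addr0.
by case: eqP.
Qed.

Lemma nact_multilinear B m : multilinear (nact B ^~ m).
Proof.
case: (mbr_nLie B) => bM _ _ i x c u v; rewrite /nact -/(emb _).
by rewrite (emb_upd x i c u v m).1 bM !(emb_upd x i c _ 0 m).2.
Qed.

Lemma nact_alternating B m : alternating (nact B ^~ m).
Proof.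
case: (mbr_nLie B) => _ bA _ x i j ij xij; rewrite /nact.
rewrite (bA _ (lift ord_max i) (lift ord_max j)) //.
  by rewrite (inj_eq (@lift_inj _ _)).
by rewrite !snoc_lift !ffunE xij.
Qed.

Lemma wact_wedgev B x m : wact B (wedgev x) m = nact B x m.
Proof.
exact: (wedge_liftE (@nact_multilinear B m) (@nact_alternating B m)).
Qed.

Lemma wact_linearl B c x y m :
  wact B (c *: x + y) m = c *: wact B x m + wact B y m.
Proof.
exact: (wedge_lift_linear (@nact_multilinear B m) (@nact_alternating B m)).
Qed.

(* For y = (y_0, ..., y_{n+1}) the sign (-1)^{n+i} of the usual 1-based      *)
(* formula with arity n becomes (-1)^{(n+2)+(i+1)}.                          *)
Definition balanced_equality (a : wedge n.+1 L -> M -> M) : Prop :=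
  forall (x : {ffun 'I_n -> L}) (y : {ffun 'I_n.+2 -> L}) (m : M),
    a (wedgev (snoc x (nbr y))) m =
    \sum_(i < n.+2) (-1) ^+ (n.+2 + i.+1) *:
      a (wedgev (del y i)) (a (wedgev (snoc x (y i))) m).

End ModuleAction.

(* Main.v *)
Require Import Defs.
From mathcomp Require Import all_boot all_order all_algebra.
From mathcomp Require Import zify.
Import GRing.Theory.
Local Open Scope ring_scope.

Set Implicit Arguments.
Unset Strict Implicit.
Unset Printing Implicit Defensive.

(** Write N = n + 2 for the arity. Everything is read off the brackets that
    contain a single entry from M. By skew-symmetry such a bracket is the
    action [x_1, ..., x_{N-1}, m] up to the sign of moving m to the last
    position (alternating_move_to_end), so an N-Lie structure on L + M that
    extends the one of L and has M as an abelian ideal is the same thing as an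
    action a(x) m, alternating in x, subject to the identities that the
    fundamental identity
      [v, [y_1, ..., y_N]] = sum_i [y_1, ..., [v, y_i], ..., y_N]
    imposes on it. With all arguments in L this is the identity of L, and with
    two arguments in M both sides vanish; so one argument is taken from M, and
    there are two places for it.

    If it is one of the y_i, say y_N = m, and v = x lies in L, the identity
    says that
      a(x) (a(y) m) = a(y) (a(x) m) + sum_i a(y_1, ..., [x, y_i], ...) m,
    which is compatibility of the action with the bracket of the exterior
    power (nact_lie, wact_wbr). If it is in v, say v = (x_1, ..., x_{N-2}, m),
    the left side is -a(x_1, ..., x_{N-2}, [y_1, ..., y_N]) m, and moving the
    inner bracket to the end on the right gives the Balanced Equality (nact_balanced). This proves the first
    half. The action descends to the quotient by the kernel of ad exactly when
    it kills that kernel, since the Lie bracket and the action on classes are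
    computed on arbitrary representatives (tilde_module).

    Conversely, given an action with these two identities, the bracket of L + M
    is forced: its L-component is the bracket of L, and its M-component is the
    signed sum over the position of the entry taken from M (semidirect_br). The
    M-component of the fundamental identity is additive over those
    positions; the part coming from the y_k is the first identity and the part
    coming from the entries of v is the second (semidirect_br_nLie). *)

(** * Finite families with one entry replaced or removed *)

Section FamilyOperations.

Definition map_family (V W : Type) (g : V -> W) k (x : {ffun 'I_k -> V}) :
  {ffun 'I_k -> W} := [ffun i => g (x i)].

Variables (V W : Type) (g : V -> W).

Lemma map_family_snoc k (x : {ffun 'I_k -> V}) z :
  map_family g (snoc x z) = snoc (map_family g x) (g z).
Proof.
apply/ffunP => j; rewrite !ffunE.
by case: unliftP => [j'|] _ //=; rewrite ffunE.
Qed.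

Lemma map_family_upd k (x : {ffun 'I_k -> V}) i z :
  map_family g (upd x i z) = upd (map_family g x) i (g z).
Proof. by apply/ffunP => j; rewrite !ffunE; case: eqP. Qed.

Lemma map_family_del k (x : {ffun 'I_k.+1 -> V}) i :
  map_family g (del x i) = del (map_family g x) i.
Proof. by apply/ffunP => j; rewrite !ffunE. Qed.

Lemma upd_same k (x : {ffun 'I_k -> V}) i z : upd x i z i = z.
Proof. by rewrite ffunE eqxx. Qed.

Lemma upd_lift k (x : {ffun 'I_k.+1 -> V}) i j z : upd x (lift i j) z i = x i.
Proof. by rewrite ffunE (negPf (neq_lift _ _)). Qed.

Lemma del_upd k (x : {ffun 'I_k.+1 -> V}) i z : del (upd x i z) i = del x i.
Proof. by apply/ffunP => j; rewrite !ffunE eq_sym (negPf (neq_lift _ _)). Qed.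

Lemma del_upd_lift k (x : {ffun 'I_k.+1 -> V}) i j z :
  del (upd x (lift i j) z) i = upd (del x i) j z.
Proof. by apply/ffunP => l; rewrite !ffunE (inj_eq (@lift_inj _ _)). Qed.

Lemma del_snoc_max k (x : {ffun 'I_k -> V}) z : del (snoc x z) ord_max = x.
Proof. by apply/ffunP => j; rewrite ffunE snoc_lift. Qed.

Lemma del_snoc_lift k (x : {ffun 'I_k.+1 -> V}) z i :
  del (snoc x z) (lift ord_max i) = snoc (del x i) z.
Proof.
apply/ffunP => j; rewrite !ffunE.
case: (unliftP ord_max j) => [j'|] -> /=.
  have -> : lift (lift ord_max i) (lift ord_max j') = lift ord_max (lift i j').
    by apply/val_inj; have := ltn_ord i; have := ltn_ord j'; rewrite /= /bump; lia.
  by rewrite liftK /= ffunE.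
have -> : lift (lift ord_max i) ord_max = ord_max :> 'I_k.+2.
  by apply/val_inj; have := ltn_ord i; rewrite /= /bump; lia.
by rewrite unlift_none.
Qed.

(** Removing positions i and j in either order; i' and j' are the positions
    that i and j take once the other one has been removed. *)
Lemma del_del k (x : {ffun 'I_k.+2 -> V}) i j i' j' :
  j = lift i j' -> i = lift j i' -> del (del x i) j' = del (del x j) i'.
Proof.
move=> jE iE; apply/ffunP => l; rewrite !ffunE; congr (x _).
have := congr1 val jE; have := congr1 val iE => /=.
by move=> h1 h2; apply/val_inj; move: h1 h2; rewrite /= /bump; lia.
Qed.

End FamilyOperations.

(** * Moving an entry of an alternating map to the last position *)

Section MoveToEnd.
Variables (F : fieldType) (V W : lmodType F).

Lemma multilinear_eq0 k (f : {ffun 'I_k -> V} -> W) (x : {ffun 'I_k -> V}) i :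
  multilinear f -> x i = 0 -> f x = 0.
Proof. by move=> fM xi; rewrite -[x](upd_id _ i) xi multilinear0. Qed.

(** The entry z passes the k - i entries to its right by adjacent
    transpositions, each of which changes the sign; k + i has the parity of
    k - i. *)
Lemma alternating_move_to_end k (f : {ffun 'I_k.+1 -> V} -> W)
    (y : {ffun 'I_k.+1 -> V}) (i : 'I_k.+1) z :
  multilinear f -> alternating f ->
  f (upd y i z) = (-1) ^+ (k + i) *: f (snoc (del y i) z).
Proof.
move=> fM fA.
move: {2}(k - i)%N (erefl (k - i)%N) => m.
elim: m i y => [|m IH] i y mE.
  have -> : i = ord_max by apply/val_inj => /=; have := ltn_ord i; lia.
  rewrite -signr_odd /= oddD addbb expr0 scale1r; congr f.
  apply/ffunP => j; rewrite !ffunE; case: unliftP => [j'|] -> /=.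
    by rewrite ffunE eq_sym (negPf (neq_lift _ _)).
  by rewrite eqxx.
have ltik : (i.+1 < k.+1)%N by lia.
pose i' := Ordinal ltik.
have ii' : i != i' by apply/eqP => /(congr1 val) /=; lia.
have mE' : (k - i')%N = m by rewrite /=; lia.
(* Exchanging z with its right neighbour y i' leaves the same family with
   position i' removed, now with z one step closer to the end. *)
have := alternating_swap y z (y i') fM fA ii'.
rewrite (updC _ _ _ ii') upd_id => /eqP; rewrite addr_eq0 => /eqP ->.
rewrite (IH i' _ mE') -scaleN1r scalerA -exprS.
(* The remaining sign (-1) ^+ (k + i).+2 is the one wanted for i. *)
rewrite [i' : nat]/= addnS -addn2 exprD.
rewrite sqrrN expr1n mulr1; congr (_ *: f (snoc _ z)).
apply/ffunP => j; rewrite !ffunE; case: ifP => [/eqP jE|jF].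
  congr (y _); apply/val_inj; have := congr1 val jE.
  by rewrite /= /bump; lia.
by congr (y _); apply/val_inj; move: jF; rewrite -val_eqE /= /bump; lia.
Qed.

End MoveToEnd.

(** * The bracket on L + M defined by an action *)

Section SemidirectBracket.
Variables (F : fieldType) (n : nat) (L : nLieAlgebra F n) (M : lmodType F).
Variable a : {ffun 'I_n.+1 -> L} -> M -> M.
Local Notation sgn i := ((-1) ^+ (n.+2 + (nat_of_ord i).+1) : F).

(** The sign of the k-th term is that of the permutation moving position k to
    the last position n.+1, as skew-symmetry of the bracket requires. *)
Definition semidirect_br (v : {ffun 'I_n.+2 -> L * M}) : L * M :=
  (nbr (map_family fst v), \sum_k sgn k *: a (del (map_family fst v) k) (v k).2).

Hypotheses (aM : forall m, multilinear (a ^~ m))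
  (aA : forall m, alternating (a ^~ m))
  (aL : forall x c m p, a x (c *: m + p) = c *: a x m + a x p).

(** Bracketing with a fixed v, as the fundamental identity does on both sides:
    the last position contributes the action on the M-component of w, without
    a sign. *)
Lemma semidirect_br_snoc (v : {ffun 'I_n.+1 -> L * M}) w :
  (semidirect_br (snoc v w)).2 = a (map_family fst v) w.2 +
    \sum_j sgn j *: a (snoc (del (map_family fst v) j) w.1) (v j).2.
Proof.
rewrite /= (bigD1_ord ord_max) //= snoc_max map_family_snoc del_snoc_max.
rewrite -signr_odd oddD addbb expr0 scale1r; congr (_ + _).
by apply: eq_bigr => j _; rewrite snoc_lift del_snoc_lift [bump _ _]lift_max.
Qed.

Lemma semidirect_br_multilinear : multilinear semidirect_br.
Proof.
case: (nbr_nLie L) => brM _ _ i v c u w.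
rewrite /semidirect_br !map_family_upd; congr pair; first exact: brM.
rewrite /= scaler_sumr -big_split; apply: eq_bigr => k _ /=.
rewrite scalerA mulrC -[X in _ = X + _]scalerA -scalerDr; congr (_ *: _).
case: (unliftP k i) => [i'|] ->.
  by rewrite !del_upd_lift aM !upd_lift.
by rewrite !del_upd !upd_same /= aL.
Qed.

(** If entries i and j agree, only the terms in which one of these two is the
    entry taken from M can survive. The two remaining families of L-components
    are the same up to the position of the repeated entry; once it is moved to
    the end in both, the terms are opposite. *)
Lemma semidirect_br_alternating : alternating semidirect_br.
Proof.
case: (nbr_nLie L) => _ brA _ v i j ij vij.
rewrite /semidirect_br (brA _ i j ij) ?ffunE ?vij //; congr pair.
set x := map_family fst v.
rewrite (bigD1 i) //= (bigD1 j) 1?eq_sym //= big1 ?addr0; last first.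
  move=> k /andP[ki kj].
  have [i' iE _] := unlift_some ki; have [j' jE _] := unlift_some kj.
  have ij' : i' != j' by apply: contra_neq ij => ij'; rewrite iE jE ij'.
  by rewrite (@aA _ _ i' j' ij') ?scaler0 // !ffunE -iE -jE vij.
have [j' jE _] := unlift_some ij.
have ji : j != i by rewrite eq_sym.
have [i' iE _] := unlift_some ji.
have xij : x i = x j by rewrite !ffunE vij.
rewrite -{1}[del x i](upd_id _ j') -{1}[del x j](upd_id _ i').
rewrite !(alternating_move_to_end _ _ _ (aM _) (@aA _)).
have -> : del x i j' = x j by rewrite ffunE -jE.
have -> : del x j i' = x j by rewrite ffunE -iE xij.
rewrite (del_del x jE iE) vij !scalerA -scalerDl.
rewrite -!exprD.
suff -> : (-1) ^+ (n.+2 + i.+1 + (n + j')) = - (-1) ^+ (n.+2 + j.+1 + (n + i')) :> F.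
  by rewrite addNr scale0r.
rewrite -[RHS]mulN1r -exprS -signr_odd -[in RHS]signr_odd.
congr ((-1) ^+ nat_of_bool _).
by have := congr1 val jE; have := congr1 val iE; rewrite /= /bump; lia.
Qed.

Hypotheses
  (a_lie : forall x y m, a x (a y m) =
     a y (a x m) + \sum_i a (upd y i (nbr (snoc x (y i)))) m)
  (a_balanced : forall (x : {ffun 'I_n -> L}) y m, a (snoc x (nbr y)) m =
     \sum_i sgn i *: a (del y i) (a (snoc x (y i)) m)).

(** Only the M-component is in question, and it is compared separately for
    each entry that supplies the element of M. *)
Lemma semidirect_br_nLie : nLie_axioms semidirect_br.
Proof.
split; [exact: semidirect_br_multilinear | exact: semidirect_br_alternating |].
case: (nbr_nLie L) => _ _ brF v y.
rewrite [LHS]surjective_pairing [RHS]surjective_pairing.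
rewrite (raddf_sum fst) (raddf_sum snd); congr pair.
  rewrite /= map_family_snoc brF; apply: eq_bigr => i _.
  by rewrite map_family_upd /= map_family_snoc ffunE.
rewrite semidirect_br_snoc /=.
set X := map_family fst v; set Y := map_family fst y.
have aD x := linD (aL x); have a_sum x := lin_sum (aL x).
have a0 x := lin0 (aL x).
have aZ x c m : a x (c *: m) = c *: a x m by rewrite -[c *: m]addr0 aL a0 addr0.
(* On the right-hand side the sum over k, the position of the element of M in
   the outer bracket, is made the outer one. In the middle expression its k-th
   term keeps the contributions of y k and of the entries of v to that
   position. *)
rewrite exchange_big /=.
transitivity (\sum_k sgn k *: (a X (a (del Y k) (y k).2) +
   \sum_j sgn j *: a (del Y k) (a (snoc (del X j) (Y k)) (v j).2))).
  under [RHS]eq_bigr => k _ do rewrite scalerDr scaler_sumr.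
  rewrite big_split /= a_sum; congr (_ + _).
    by apply: eq_bigr => k _; rewrite aZ.
  rewrite exchange_big /=; apply: eq_bigr => j _.
  rewrite a_balanced scaler_sumr; apply: eq_bigr => k _.
  by rewrite !scalerA mulrC.
apply: eq_bigr => k _.
(* The inner bracket sits at position k itself, or at some lift k j, in which
   case the element of M is the one of y k and a_lie collects these terms. *)
rewrite (bigD1_ord k) //= map_family_upd -/Y del_upd upd_same semidirect_br_snoc.
rewrite -/X aD a_sum a_lie !scalerDr -!addrA; congr (_ + _).
rewrite addrC; congr (_ + _).
  by congr (_ *: _); apply: eq_bigr => j _; rewrite aZ ffunE.
rewrite scaler_sumr.
apply: eq_bigr => j _.
rewrite map_family_upd -/Y del_upd_lift upd_lift /= map_family_snoc.
by rewrite [del _ _ _]ffunE [map_family _ _ _]ffunE.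
Qed.

Lemma semidirect_br_subalgebra (x : {ffun 'I_n.+2 -> L}) :
  semidirect_br [ffun i => (x i, 0)] = (nbr x, 0).
Proof.
rewrite /semidirect_br; congr (nbr _, _).
  by apply/ffunP => i; rewrite !ffunE.
by rewrite big1 // => k _; rewrite ffunE (lin0 (aL _)) scaler0.
Qed.

Lemma semidirect_br_ideal (v : {ffun 'I_n.+2 -> L * M}) i :
  (v i).1 = 0 -> (semidirect_br v).1 = 0.
Proof.
case: (nbr_nLie L) => brM _ _ vi.
by apply: (multilinear_eq0 (i := i) brM); rewrite ffunE.
Qed.

Lemma semidirect_br_abelian (v : {ffun 'I_n.+2 -> L * M}) i j :
  i != j -> (v i).1 = 0 -> (v j).1 = 0 -> semidirect_br v = 0.
Proof.
move=> ij vi vj; rewrite [LHS]surjective_pairing (semidirect_br_ideal vi).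
congr pair; apply: big1 => k _.
have [l kl vl] : exists2 l, k != l & (v l).1 = 0.
  by have [->|ki] := eqVneq k i; [exists j | exists i].
have [l' lE _] := unlift_some kl.
by rewrite (multilinear_eq0 (i := l') (@aM _)) ?scaler0 // !ffunE -lE.
Qed.

Definition semidirect_module : nLieModule L M :=
  NLieModule semidirect_br_nLie semidirect_br_subalgebra semidirect_br_ideal
    semidirect_br_abelian.

Lemma nact_semidirect x m : nact semidirect_module x m = a x m.
Proof.
rewrite /nact [mbr _]/= semidirect_br_snoc big1 ?addr0 => [|j _].
  by congr a; apply/ffunP => i; rewrite !ffunE.
by rewrite ffunE (lin0 (aL _)) scaler0.
Qed.

End SemidirectBracket.

(** * Identities satisfied by a module over an n-Lie algebra *)

Section ModuleIdentities.
Variables (F : fieldType) (n : nat) (L : nLieAlgebra F n) (M : lmodType F).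
Variable B : nLieModule L M.
Local Notation sgn i := ((-1) ^+ (n.+2 + (nat_of_ord i).+1) : F).
Local Notation emb := (map_family (fun x : L => (x, 0 : M))).

Lemma mbr_snoc x m : mbr B (snoc (emb x) (0, m)) = (0, nact B x m).
Proof.
rewrite [LHS]surjective_pairing; congr pair.
by apply: (@mbr_ideal _ _ _ _ B _ ord_max); rewrite snoc_max.
Qed.

Lemma mbr_upd y i m :
  mbr B (upd (emb y) i (0, m)) = (0, sgn i *: nact B (del y i) m).
Proof.
case: (mbr_nLie B) => bM bA _.
rewrite alternating_move_to_end // -map_family_del mbr_snoc.
have -> : (n.+2 + i.+1 = n.+1 + i + 2)%N by lia.
rewrite [in RHS]exprD sqrrN expr1n mulr1.
by congr pair; rewrite /= ?scaler0.
Qed.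

Lemma nact_linear x c m p : nact B x (c *: m + p) = c *: nact B x m + nact B x p.
Proof.
case: (mbr_nLie B) => bM _ _.
rewrite /nact -(upd_snoc_max _ (0, 0)).
have -> : (0, c *: m + p) = c *: (0, m) + (0, p) :> L * M.
  by congr pair; rewrite /= scaler0 addr0.
by rewrite bM !upd_snoc_max.
Qed.

(** The fundamental identity for x and (y_1, ..., y_{n-1}, m): the term of the
    right-hand side in which x acts on m is the composite in the other order. *)
Lemma nact_lie x y m : nact B x (nact B y m) =
  nact B y (nact B x m) + \sum_i nact B (upd y i (nbr (snoc x (y i)))) m.
Proof.
case: (mbr_nLie B) => _ _ /(_ (emb x) (snoc (emb y) (0, m))).
rewrite mbr_snoc mbr_snoc (bigD1_ord ord_max) //=.
rewrite snoc_max mbr_snoc upd_snoc_max mbr_snoc => /(congr1 snd) /= ->.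
rewrite (raddf_sum snd); congr (_ + _); apply: eq_bigr => i _.
rewrite snoc_lift upd_snoc_lift ffunE -map_family_snoc mbr_subalgebra.
by rewrite -(map_family_upd (fun x : L => (x, 0 : M))) mbr_snoc.
Qed.

(** A transposition of the last two entries, hence the minus sign. *)
Lemma mbr_snoc_snoc (x : {ffun 'I_n -> L}) w m :
  mbr B (snoc (snoc (emb x) (0, m)) (w, 0)) = (0, - nact B (snoc x w) m).
Proof.
(* The entry 0 is a placeholder for the position of m. *)
have -> : snoc (snoc (emb x) (0, m)) (w, 0) =
    upd (emb (snoc (snoc x 0) w)) (lift ord_max ord_max) (0, m).
  by rewrite !map_family_snoc upd_snoc_lift upd_snoc_max.
rewrite mbr_upd del_snoc_lift del_snoc_max lift_max /=.
by rewrite -signr_odd (_ : odd _ = true) ?scaleN1r //; lia.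
Qed.

(** The fundamental identity for (x_1, ..., x_{n-2}, m) and (y_1, ..., y_n). On
    the right-hand side the inner bracket lies in M and takes the place of y_i;
    moving it to the end produces the sign of the i-th term. *)
Lemma nact_balanced (x : {ffun 'I_n -> L}) y m : nact B (snoc x (nbr y)) m =
  \sum_i sgn i *: nact B (del y i) (nact B (snoc x (y i)) m).
Proof.
case: (mbr_nLie B) => _ _ /(_ (snoc (emb x) (0, m)) (emb y)).
rewrite mbr_subalgebra mbr_snoc_snoc => /(congr1 snd) /= /(congr1 -%R).
rewrite opprK => ->; rewrite (raddf_sum snd) -sumrN; apply: eq_bigr => i _.
rewrite ffunE mbr_snoc_snoc mbr_upd /= -[- nact _ _ _]addr0 -scaleN1r nact_linear.
by rewrite (lin0 (nact_linear _)) addr0 scaleN1r scalerN opprK.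
Qed.

Lemma wact0l m : wact B 0 m = 0.
Proof. exact: (lin0 (fun c x y => wact_linearl B c x y m)). Qed.

Lemma wact_linearr u c m p : wact B u (c *: m + p) = c *: wact B u m + wact B u p.
Proof.
elim/wedge_ind: u => [|b t u IH].
  by rewrite !wact0l scaler0 addr0.
rewrite !wact_linearl !wact_wedgev IH nact_linear !scalerDr !scalerA.
by rewrite [c * b]mulrC addrACA.
Qed.

Lemma wact0r u : wact B u 0 = 0.
Proof. exact: (lin0 (wact_linearr u)). Qed.

(** Both sides are linear in u and v, so the identity reduces to decomposable
    elements, where it is nact_lie. *)
Lemma wact_wbr u v m :
  wact B (wbr u v) m = wact B u (wact B v m) - wact B v (wact B u m).
Proof.
have wact_sum := fun I (r : seq I) => lin_sum (g := wact B ^~ m)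
  (fun c x y => wact_linearl B c x y m) r.
elim/wedge_ind: v => [|c t v IH].
  by rewrite wbr0r !wact0l wact0r subr0.
rewrite wbr_linearr !wact_linearl IH wact_linearr opprD addrACA.
congr (_ + _); rewrite -scalerBr; congr (_ *: _).
(* v is now decomposable, and u is decomposed in turn. *)
rewrite wbr_wedgev wact_sum !wact_wedgev {c v IH}.
under eq_bigr => i _ do rewrite wact_wedgev.
elim/wedge_ind: u => [|c s u IH].
  rewrite !wact0l (lin0 (nact_linear _)) subr0 big1 // => i _.
  by rewrite ad0l (multilinear0 _ _ (@nact_multilinear _ _ _ _ B m)).
under eq_bigr => i _ do
  rewrite ad_linearl (nact_multilinear B m) ad_wedgev.
rewrite big_split /= -scaler_sumr IH !wact_linearl nact_linear !wact_wedgev.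
rewrite nact_lie opprD addrACA; congr (_ + _).
by rewrite -scalerBr addrAC subrr add0r.
Qed.

Lemma wact_balanced : balanced_equality (wact B).
Proof.
move=> x y m; rewrite wact_wedgev nact_balanced.
by apply: eq_bigr => i _; rewrite !wact_wedgev.
Qed.

(** ** Passage to the quotient by the kernel of ad *)

Section Descent.
Hypothesis wact_ker : forall u : wedge n.+1 L,
  (forall z : L, ad u z = 0) -> forall m, wact B u m = 0.

Lemma wact_ad u v : (forall z, ad u z = ad v z) -> forall m, wact B u m = wact B v m.
Proof.
move=> uv m; apply/subr0_eq.
rewrite -(linB (g := wact B ^~ m) (fun c x y => wact_linearl B c x y m)).
apply: wact_ker => z.
rewrite (linB (g := fun w : wedge n.+1 L => ad w z)
  (fun c x y => ad_linearl c x y z)).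
by rewrite uv subrr.
Qed.

(** The quotient provides chosen representatives; wact_ad makes the choice
    immaterial, so every module axiom can be checked on any element of the
    exterior power with the right ad. *)
Definition tilde_module : lieModule (tildeL L) M.
Proof.
refine (@LieModule _ (tildeL L) M (fun p m => wact B (lrepr (p : tsort L)) m) _ _ _)
  => [c p q m|c p m m'|p q m].
- rewrite -wact_linearl; apply: wact_ad => z.
  by rewrite tad_linear ad_linearl.
- exact: wact_linearr.
- rewrite -wact_wbr; apply: wact_ad => z.
  exact: ad_lrepr_lpi.
Defined.

Lemma tilde_moduleE u m : tilde_module (tclass u) m = wact B u m.
Proof. by apply: wact_ad => z; rewrite ad_lrepr_lpi. Qed.

End Descent.
End ModuleIdentities.

(** * Modules over an n-Lie algebra and over its associated Lie algebra *)

Theorem proposition4p2 (F : fieldType) (n : nat) (L : nLieAlgebra F n)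
    (M : lmodType F) :
  (forall B : nLieModule L M,
    [/\ (forall (u v : wedge n.+1 L) (m : M),
           wact B (wbr u v) m =
           wact B u (wact B v m) - wact B v (wact B u m)),
        balanced_equality (wact B) &
        (forall u : wedge n.+1 L,
           (forall z : L, ad u z = 0) -> forall m : M, wact B u m = 0) <->
        (exists rho : lieModule (tildeL L) M,
           (forall (x : {ffun 'I_n.+1 -> L}) (m : M),
              rho (tclass (wedgev x)) m = nact B x m) /\
           balanced_equality (fun u => rho (tclass u)))]) /\
  (forall rho : lieModule (tildeL L) M,
    balanced_equality (fun u => rho (tclass u)) ->
    exists B : nLieModule L M,
      forall (x : {ffun 'I_n.+1 -> L}) (m : M),
        nact B x m = rho (tclass (wedgev x)) m).
Proof.
have tclass_linear c (u v : wedge n.+1 L) :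
    tclass (c *: u + v) = c *: tclass u + tclass v by exact: lpi_linear.
split=> [B|rho rho_balanced].
  split; [exact: wact_wbr | exact: wact_balanced |].
  split=> [wact_ker|[rho [rhoE _]] u adu m].
    exists (tilde_module wact_ker); split=> [x m|x y m].
      by rewrite tilde_moduleE wact_wedgev.
    rewrite tilde_moduleE wact_balanced; apply: eq_bigr => i _.
    by rewrite !tilde_moduleE.
  have rho0 : rho 0 m = 0 := lin0 (fun c p q => lact_linearl rho c p q m).
  have -> : wact B u m = rho (tclass u) m.
    elim/wedge_ind: u {adu} => [|c x u IH].
      by rewrite wact0l (lin0 tclass_linear) rho0.
    by rewrite wact_linearl tclass_linear lact_linearl wact_wedgev rhoE IH.
  suff -> : tclass u = 0 by [].
  (* Classes are equal as soon as their representatives have the same ad. *)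
  apply: tsort_inj => z; rewrite -[in RHS](lin0 tclass_linear).
  by rewrite !ad_lrepr_lpi adu ad0l.
pose a (x : {ffun 'I_n.+1 -> L}) m := rho (tclass (wedgev x)) m.
have aM m : multilinear (a ^~ m).
  by move=> i x c u v; rewrite /a wedgev_multilinear tclass_linear lact_linearl.
have aA m : alternating (a ^~ m).
  move=> x i j ij xij; rewrite /a (wedgev_alternating ij xij) (lin0 tclass_linear).
  exact: (lin0 (fun c p q => lact_linearl rho c p q m)).
have aL x : forall c m p, a x (c *: m + p) = c *: a x m + a x p.
  by move=> c m p; rewrite /a lact_linearr.
(* A module over the quotient respects its bracket, which on classes of
   decomposable elements is given by wbr. *)
have a_lie x y m : a x (a y m) =
    a y (a x m) + \sum_i a (upd y i (nbr (snoc x (y i)))) m.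
  apply/eqP; rewrite addrC -subr_eq; apply/eqP.
  rewrite /a -(lact_lbr rho) [lbr _ _]tbr_wbr wbr_wedgev -/(tclass _).
  rewrite (lin_sum tclass_linear).
  rewrite (lin_sum (g := rho ^~ m) (fun c p q => lact_linearl rho c p q m)).
  by apply: eq_bigr => i _; rewrite ad_wedgev.
by exists (semidirect_module aM aA aL a_lie rho_balanced) => x m;
  rewrite nact_semidirect.
Qed.
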